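(* Let $0<\alpha \le 1/6$ and let $\mathsf{Halver}$ be a data-oblivious $\alpha$-halver procedure operating on pairs of equal-sized arrays whose size is a power of $2$. Then the procedure $\mathsf{Reduce}$ (defined in the context, built from $\mathsf{Halver}$) is an $(\alpha\delta,5/6)$-halver for every $\delta$ satisfying $\delta \ge \alpha + \alpha\delta + \delta^2$.
   Context: A compare-exchange on positions $(p,q)$ replaces the values $(x,y)$ there by $(\min(x,y),\max(x,y))$; a procedure is data-oblivious if its sequence of compare-exchanges/memory accesses is independent of the input values. For $\epsilon\ge0$, an $\epsilon$-halver is a data-oblivious procedure that, given arrays $(A,B)$ each of size $n$, performs compare-exchanges so that afterwards, for every $k\le n$, at most $\epsilon k$ of the $k$ largest elements of $A\cup B$ are in $A$ and at most $\epsilon k$ of the $k$ smallest are in $B$. For $0<\lambda<1$, an $(\epsilon,\lambda)$-halver satisfies this requirement for all $k\le \lambda n$. ''Sort $A\cup B$'' means rearranging the $2n$ items so that the concatenation $AB$ is in nondecreasing order; ''partition $E$ into halves $F,G$'' means viewing the first half of subarray $E$ as $F$ and the second half as $G$. Procedure $\mathsf{Attenuate}(A,B)$, with $|A|=|B|=n$ a power of 2: if $n\le 8$, sort $A\cup B$ and return. Otherwise partition $A$ into halves $A_1,A_2$ and $B$ into halves $B_1,B_2$; run $\mathsf{Halver}(A_1,A_2)$, $\mathsf{Halver}(B_1,B_2)$, $\mathsf{Halver}(A_2,B_1)$, then $\mathsf{Attenuate}(A_2,B_1)$; then partition $A_2$ into halves $A_{21},A_{22}$ and $B_1$ into halves $B_{11},B_{12}$;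 run $\mathsf{Halver}(A_{21},A_{22})$, $\mathsf{Halver}(B_{11},B_{12})$, $\mathsf{Halver}(A_{22},B_{11})$, then $\mathsf{Attenuate}(A_{22},B_{11})$. Procedure $\mathsf{Reduce}(A,B)$: if $n\le 8$, sort $A\cup B$ and return; otherwise run $\mathsf{Halver}(A,B)$ and then $\mathsf{Attenuate}(A,B)$.
   Formalization: Every compare-exchange on positions (p,q) used by Halver and by the sorting of small arrays is required to have p<q in the concatenation AB (minimum to the earlier position); with reversed exchanges allowed the claim fails for small α. *)

(* Defs.v *)
From mathcomp Require Import all_boot all_order all_algebra.
Set Implicit Arguments.
Unset Strict Implicit.
Unset Printing Implicit Defensive.
Import Order.TTheory GRing.Theory Num.Theory.

(* The compare-exchange on positions (p, q). *)
Definition compare_exchange d (T : orderType d) (x : nat -> T) (c : nat * nat)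
    : nat -> T :=
  fun i => if i == c.1 then Order.min (x c.1) (x c.2)
           else if i == c.2 then Order.max (x c.1) (x c.2)
           else x i.

(* A sequence of compare-exchanges fixed in advance, first one first. *)
Definition network := seq (nat * nat).

Definition run d (T : orderType d) (s : network) (x : nat -> T) : nat -> T :=
  foldl (@compare_exchange d T) x s.

(* A data-oblivious procedure on pairs (A, B) of arrays of size n = 2 ^ m: the
   network [P m] depends on the size only.  It is written for the concatenation
   AB, cells 0 .. n - 1 being A and cells n .. 2n - 1 being B. *)
Definition procedure := nat -> network.

(* Compare-exchanges are the usual ones ("swap if out of order"): they stay
   inside AB and put the minimum at the earlier position, p < q.  Without p < q
   a halver may move large elements from B back into A. *)
Definition valid_network (N : nat) (s : network) : bool :=
  all (fun c : nat * nat => c.1 < c.2 < N) s.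

Definition oblivious (P : procedure) : Prop :=
  forall m, valid_network (2 ^ m + 2 ^ m) (P m).

(* S is a set of #|S| largest (smallest) elements of the array y of size N,
   designated by their positions; it is unique when the entries of y are
   distinct, and otherwise equal entries may be ranked in any order. *)
Definition largest d (T : orderType d) N (y : nat -> T) (S : {set 'I_N}) : Prop :=
  forall i j : 'I_N, i \in S -> j \notin S -> (y j <= y i)%O.

Definition smallest d (T : orderType d) N (y : nat -> T) (S : {set 'I_N}) : Prop :=
  forall i j : 'I_N, i \in S -> j \notin S -> (y i <= y j)%O.

Definition halves_at (R : realFieldType) (eps : R) (P : procedure) (m k : nat)
    : Prop :=
  let n := 2 ^ m in
  forall d (T : orderType d) (x : nat -> T),
  let y := run (P m) x in
  (exists S : {set 'I_(n + n)},
     [/\ #|S| = k, largest y S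
       & (#|[set i in S | (i < n)%N]|%:R <= eps * k%:R)%R]) /\
  (exists S : {set 'I_(n + n)},
     [/\ #|S| = k, smallest y S
       & (#|[set i in S | (n <= i)%N]|%:R <= eps * k%:R)%R]).

Definition halver (R : realFieldType) (eps : R) (P : procedure) : Prop :=
  oblivious P /\
  forall m k, k <= 2 ^ m -> halves_at eps P m k.

Definition partial_halver (R : realFieldType) (eps lam : R) (P : procedure)
    : Prop :=
  oblivious P /\
  forall m k, (k%:R <= lam * (2 ^ m)%:R)%R -> halves_at eps P m k.

Definition sorts (P : procedure) (m : nat) : Prop :=
  valid_network (2 ^ m + 2 ^ m) (P m) /\
  forall d (T : orderType d) (x : nat -> T) (i j : nat),
    i <= j -> j < 2 ^ m + 2 ^ m -> (run (P m) x i <= run (P m) x j)%O.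

(* A subarray is the sequence of its positions in the ambient array. *)
Definition first_half (E : seq nat) : seq nat := take (size E)./2 E.
Definition second_half (E : seq nat) : seq nat := drop (size E)./2 E.

Definition call (P : procedure) (m : nat) (A B : seq nat) : network :=
  [seq (nth 0 (A ++ B) c.1, nth 0 (A ++ B) c.2) | c <- P m].

(* Here |A| = |B| = 2 ^ m; the last branch is never reached, as 8 < 2 ^ m. *)
Fixpoint attenuate (Sort Halver : procedure) (m : nat) (A B : seq nat)
    : network :=
  if 2 ^ m <= 8 then call Sort m A B else
  match m with
  | (m2.+1 as m1).+1 =>
    let A1 := first_half A in let A2 := second_half A in
    let B1 := first_half B in let B2 := second_half B in
    let A21 := first_half A2 in let A22 := second_half A2 in
    let B11 := first_half B1 in let B12 := second_half B1 in
    call Halver m1 A1 A2 ++ call Halver m1 B1 B2 ++ call Halver m1 A2 B1 ++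
    attenuate Sort Halver m1 A2 B1 ++
    call Halver m2 A21 A22 ++ call Halver m2 B11 B12 ++ call Halver m2 A22 B11 ++
    attenuate Sort Halver m2 A22 B11
  | _ => [::]
  end.

Definition reduce (Sort Halver : procedure) : procedure := fun m =>
  let A := iota 0 (2 ^ m) in
  let B := iota (2 ^ m) (2 ^ m) in
  if 2 ^ m <= 8 then call Sort m A B
  else call Halver m A B ++ attenuate Sort Halver m A B.

(* Main.v *)
(* Fix a threshold and let b be one of the two truth values; w is the number of
   b on the wrong side of AB among k <= 5n/6 in all, and w <= alpha k because a
   halver has just been run on (A, B).  The halvers on the halves of A and of B
   leave at most alpha w of the b in the far half of the wrong array.  They also
   leave at most 5/6 (n/2) of the b in the middle A_2 B_1 (a count of at most
   83 n / 216 when alpha <= 1/6), so that the recursive call applies and leaves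
   at most delta w in the near half.  The second phase does the same to the
   middle.  What is left on the wrong side is at most
   alpha w + alpha (delta w) + delta (delta w) <= delta w. *)
Require Import Defs.
From mathcomp Require Import all_boot all_order all_algebra.
From mathcomp Require Import zify lra.
Import Order.TTheory GRing.Theory Num.Theory.
Set Implicit Arguments.
Unset Strict Implicit.
Unset Printing Implicit Defensive.

(** * Networks confined to an interval, their runs and their translates *)

(** At [a = 0] this is convertible to [valid_network N]; later proofs pass from one to the other
    silently. *)
Definition inside (a N : nat) (s : network) : bool :=
  all (fun c : nat * nat => (a <= c.1) && (c.1 < c.2 < a + N)) s.

Definition shift (a : nat) (s : network) : network :=
  [seq (a + c.1, a + c.2) | c <- s].

Lemma inside_cat a N s t : inside a N (s ++ t) = inside a N s && inside a N t.
Proof. exact: all_cat. Qed.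

Lemma inside_widen a N a' N' s :
  a' <= a -> a + N <= a' + N' -> inside a N s -> inside a' N' s.
Proof.
move=> ha hN; apply: sub_all => c /andP[h1 /andP[h2 h3]]; apply/andP; lia.
Qed.

Lemma inside_shift a N s : valid_network N s -> inside a N (shift a s).
Proof.
rewrite /inside all_map; apply: sub_all => c /andP[h1 h2] /=; apply/andP; lia.
Qed.

Lemma run_cat d (T : orderType d) s t (x : nat -> T) :
  run (s ++ t) x = run t (run s x).
Proof. exact: foldl_cat. Qed.

(** A monotone map commutes with [min] and [max]; this is the core of the 0-1 principle. *)
Lemma run_homo d d' (T : orderType d) (T' : orderType d') (f : T -> T')
    (s : network) (x : nat -> T) :
  {homo f : u v / (u <= v)%O} -> run s (f \o x) =1 f \o run s x.
Proof.
move=> f_homo; elim/last_ind: s => [//|s c IHs] i.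
rewrite /run !foldl_rcons -/(run s _) -/(run s _) /compare_exchange /= !IHs /=.
case: eqP => _; first by case: (leP (run s x c.1)) => [|/ltW] /f_homo h;
  [exact: min_l | exact: min_r].
by case: eqP => _ //; case: (leP (run s x c.1)) => [|/ltW] /f_homo h;
  [exact: max_r | exact: max_l].
Qed.

Lemma compare_exchange_inj d (T : orderType d) (x : nat -> T) c :
  c.1 != c.2 -> injective x -> injective (compare_exchange x c).
Proof.
case: c => p q /= pq x_inj i j; rewrite /compare_exchange /=.
case: (leP (x p) (x q)) => _; do 4?[case: eqP => ?]; subst => //;
  by move=> /x_inj ?; subst; rewrite ?eqxx in pq *.
Qed.

Lemma run_inj d (T : orderType d) N s (x : nat -> T) :
  valid_network N s -> injective x -> injective (run s x).
Proof.
elim/last_ind: s => [//|s c IHs]; rewrite /valid_network all_rcons.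
case/andP=> /andP[c_lt _] s_ok x_inj; rewrite /run foldl_rcons.
apply: compare_exchange_inj; first by rewrite neq_ltn c_lt.
exact: IHs.
Qed.

Lemma run_shift d (T : orderType d) a s (x : nat -> T) i :
  run (shift a s) x (a + i) = run s (fun j => x (a + j)) i.
Proof.
elim/last_ind: s i => [//|s c IHs] i.
rewrite /shift map_rcons /run !foldl_rcons -/(run _ _) -/(run _ _).
by rewrite /compare_exchange /= !eqn_add2l !IHs.
Qed.

Lemma run_outside d (T : orderType d) a N s (x : nat -> T) j :
  inside a N s -> (j < a) || (a + N <= j) -> run s x j = x j.
Proof.
move=> s_in j_out; elim/last_ind: s s_in => [//|s c IHs].
rewrite /inside all_rcons => /andP[/andP[c1 c2] s_in].
rewrite /run foldl_rcons -/(run s x) /compare_exchange.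
by rewrite !ifN ?IHs //; apply/eqP; lia.
Qed.

(** * Counting entries of boolean arrays *)

Definition cnt (b : bool) (x : nat -> bool) (a n : nat) : nat :=
  count (fun i => x i == b) (iota a n).

(* The number of entries [b] of the adjacent arrays A = [a, a + n) and
   B = [a + n, a + 2n) on the wrong side, a sorted array having its entries
   [true] in B. *)
Definition wcnt (b : bool) (x : nat -> bool) (a n : nat) : nat :=
  cnt b x (if b then a else a + n) n.

Lemma cntD b x a n1 n2 : cnt b x a (n1 + n2) = cnt b x a n1 + cnt b x (a + n1) n2.
Proof. by rewrite /cnt iotaD count_cat. Qed.

Lemma cntC b x a n : cnt b x a n + cnt (~~ b) x a n = n.
Proof.
rewrite -[RHS](size_iota a) -(count_predC (fun i => x i == b)); congr (_ + _).
by apply: eq_count => i /=; case: (x i) b => [] [].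
Qed.

Lemma eq_cnt b x y a n :
  (forall i, a <= i < a + n -> x i = y i) -> cnt b x a n = cnt b y a n.
Proof. by move=> xy; apply: eq_in_count => i; rewrite mem_iota => /xy ->. Qed.

Lemma cnt_shift b x a c n : cnt b x (a + c) n = cnt b (fun i => x (a + i)) c n.
Proof. by rewrite /cnt iotaDl count_map. Qed.

(** Since neither position lies before [a], only an exchange across the right end of the interval
    matters, and it can only carry a [true] out. *)
Lemma cnt_compare_exchange (x : nat -> bool) c a n :
  a <= c.1 < c.2 ->
  cnt true (compare_exchange x c) a n
    + [&& c.1 < a + n <= c.2, x c.1 & ~~ x c.2] = cnt true x a n.
Proof.
case: c => p q /= /andP[ap pq]; elim: n => [|n IHn].
  by rewrite /cnt /= addn0 ltnNge ap.
rewrite -addn1 !cntD -{}IHn addn1 /cnt /= !addn0 /compare_exchange /= addnS.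
have [->|np] := eqVneq (a + n) p.
  by rewrite ltnn ltnSn pq /= addn0; case: (x p) (x q) => [] []; rewrite /= ?addn0.
have [->|nq] := eqVneq (a + n) q.
  by rewrite ltnn pq leqnn andbF /= addn0; case: (x p) (x q) => [] []; rewrite /= ?addn0 ?addn1.
have -> : (p < (a + n).+1 <= q) = (p < a + n <= q) by apply/idP/idP; lia.
by rewrite addnAC.
Qed.

Lemma cnt_prefix_run a N s x n : inside a N s ->
  cnt true (run s x) a n <= cnt true x a n.
Proof.
elim/last_ind: s => [//|s c IHs].
rewrite /inside all_rcons => /andP[/andP[c1 /andP[c2 _]] s_in].
rewrite /run foldl_rcons -/(run s x) (leq_trans _ (IHs s_in)) //.
by rewrite -(@cnt_compare_exchange (run s x) c) ?c1 // leq_addr.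
Qed.

Lemma cnt_run a N s x b : inside a N s -> cnt b (run s x) a N = cnt b x a N.
Proof.
move=> s_in; suff : cnt true (run s x) a N = cnt true x a N.
  by case: b => // eqT; have := cntC true x a N;
    have := cntC true (run s x) a N => /=; lia.
elim/last_ind: s s_in => [//|s c IHs].
rewrite /inside all_rcons => /andP[/andP[c1 /andP[c2 c3]] s_in].
rewrite /run foldl_rcons -/(run s x) -(IHs s_in).
rewrite -(@cnt_compare_exchange (run s x) c) ?c1 //.
by rewrite [_ <= c.2]leqNgt c3 andbF addn0.
Qed.

Lemma cnt_run_outside a N s x b c n : inside a N s ->
  (c + n <= a) || (a + N <= c) -> cnt b (run s x) c n = cnt b x c n.
Proof.
by move=> s_in out; apply: eq_cnt => i hi; apply: run_outside s_in _; lia.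
Qed.

(** The left array can only lose entries [true]; as totals are conserved, the right array can only
    lose entries [false]. *)
Lemma wcnt_run a n s x b : inside a (n + n) s ->
  wcnt b (run s x) a n <= wcnt b x a n.
Proof.
move=> s_in; have := cnt_prefix_run x n s_in.
have := cnt_run x true s_in; rewrite !cntD /wcnt.
have := cntC true x (a + n) n; have := cntC true (run s x) (a + n) n.
by case: b => /=; lia.
Qed.

(** * From sets of positions to counts, and the 0-1 principle *)

Lemma card_ord_count N (P : pred nat) :
  #|[set i : 'I_N | P i]| = count P (iota 0 N).
Proof.
by rewrite cardsE cardE size_filter -enumT -val_enum_ord count_map.
Qed.

Lemma card_wrong b (y : nat -> bool) n :
  #|[set i : 'I_(n + n) | (y i == b) && (if b then i < n else n <= i)]|
    = wcnt b y 0 n.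
Proof.
rewrite (card_ord_count _ (fun i => (y i == b) && (if b then i < n else n <= i))).
rewrite iotaD count_cat /wcnt add0n.
have cnt_in (Q : pred nat) c : (forall i, c <= i < c + n -> Q i) ->
    count (fun i => (y i == b) && Q i) (iota c n) = cnt b y c n.
  by move=> hQ; apply: eq_in_count => i; rewrite mem_iota => /hQ ->; rewrite andbT.
have cnt_out (Q : pred nat) c : (forall i, c <= i < c + n -> ~~ Q i) ->
    count (fun i => (y i == b) && Q i) (iota c n) = 0.
  move=> hQ; apply/eqP; rewrite -leqn0 leqNgt -has_count; apply/hasPn => i.
  by rewrite mem_iota negb_and => /hQ ->; rewrite orbT.
case: b cnt_in cnt_out => cnt_in cnt_out.
  by rewrite cnt_in 1?cnt_out ?addn0 // => i; lia.
by rewrite cnt_out 1?cnt_in ?add0n // => i; lia.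
Qed.

(** Greedy choice: a maximal remaining entry is added [k] times. *)
Lemma largest_exists d (T : orderType d) N (y : nat -> T) k : k <= N ->
  exists S : {set 'I_N}, #|S| = k /\ largest y S.
Proof.
elim: k => [|k IHk] kN; first by exists set0; rewrite cards0; split=> // i j;
  rewrite in_set0.
have [S [Sk S_max]] := IHk (ltnW kN).
have [i0 i0S] : exists i, i \notin S.
  suff /set0Pn[i]: ~: S != set0 by rewrite inE; exists i.
  by rewrite -card_gt0 cardsCs setCK card_ord Sk subn_gt0.
have [i iS i_max] := @arg_maxP _ T _ i0 (fun i => i \notin S) (fun i : 'I_N => y i) i0S.
exists (i |: S); rewrite cardsU1 iS Sk; split=> // u v.
rewrite !inE negb_or => /orP[/eqP ->|uS] /andP[_ vS]; last exact: S_max.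
exact: i_max.
Qed.

(* By the 0-1 principle the halver property need only be checked on arrays of
   booleans, where it concerns both values symmetrically. *)
Definition halves01 (R : realFieldType) (eps : R) (s : network) (n k : nat) :=
  forall b x, cnt b x 0 (n + n) = k ->
  ((wcnt b (run s x) 0 n)%:R <= eps * k%:R)%R.

Lemma halves_at_bool (R : realFieldType) (eps : R) (P : procedure) m k :
  valid_network (2 ^ m + 2 ^ m) (P m) ->
  halves_at eps P m k -> halves01 eps (P m) (2 ^ m) k.
Proof.
set n := 2 ^ m => P_ok P_halves b x.
rewrite -(@cnt_run 0 _ (P m) x b P_ok) => yk.
have [[S [Sk S_max S_le]] [S' [Sk' S_min S_le']]] := P_halves _ _ x.
(* Exactly [k] entries equal [b]. If [U] missed one of them, all of [U] would be [b], which makes at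
   least [k + 1]. *)
have ordered_set (U : {set 'I_(n + n)}) : #|U| = k ->
    (forall i j, i \in U -> j \notin U -> run (P m) x j == b -> run (P m) x i == b) ->
    U = [set i : 'I_(n + n) | run (P m) x i == b].
  move=> Uk U_ord; apply/eqP; rewrite eq_sym eqEcard Uk.
  have Yk : #|[set i : 'I_(n + n) | run (P m) x i == b]| = k.
    by rewrite (card_ord_count _ (fun i => run (P m) x i == b)).
  rewrite Yk leqnn andbT; apply/subsetP => j jb; apply: contraTT isT => jU.
  suff /subset_leq_card : U \subset [set i : 'I_(n + n) | run (P m) x i == b] :\ j.
    by have := cardsD1 j [set i : 'I_(n + n) | run (P m) x i == b];
      rewrite jb Yk Uk => ->; rewrite ltnn.
  apply/subsetP => i iU; rewrite !inE; rewrite inE in jb.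
  by rewrite (U_ord i j) // andbT; apply: contraNneq jU => <-.
rewrite -card_wrong; case: b yk ordered_set => yk ordered_set.
  rewrite (ordered_set S) // in S_le.
    by move: S_le; under eq_finset do rewrite !inE.
  by move=> i j iS jS; have := S_max i j iS jS;
    case: (run _ _ i) (run _ _ j) => [] [].
rewrite (ordered_set S') // in S_le'.
  by move: S_le'; under eq_finset do rewrite !inE.
by move=> i j iS jS; have := S_min i j iS jS;
  case: (run _ _ i) (run _ _ j) => [] [].
Qed.

(* Breaking ties by the initial position makes the items distinct. *)
Definition ranked d (T : orderType d) (x : nat -> T) (i : nat)
  : (T *lexi[Order.lexi_display d Order.NatOrder.nat_display] nat)%type := (x i, i).

Lemma ranked_inj d (T : orderType d) (x : nat -> T) : injective (ranked x).
Proof. by move=> i j []. Qed.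

(** The first projection is monotone for the lexicographic order. *)
Lemma run_ranked d (T : orderType d) s (x : nat -> T) i :
  (run s (ranked x) i).1 = run s x i.
Proof.
have fst_homo : {homo (@fst T nat : T *l nat -> T) : u v / (u <= v)%O}.
  by move=> u v; rewrite leEprodlexi => /andP[].
by symmetry; exact: (run_homo s (ranked x) fst_homo i).
Qed.

(** The witness is the indicator of the up-set generated by the values on [S]; injectivity prevents
    an entry outside [S] from tying with one inside. *)
Lemma threshold d (T : orderType d) N (y : nat -> T) (S : {set 'I_N}) :
    injective y -> largest y S ->
  exists2 f : T -> bool, {homo f : u v / (u <= v)%O}
    & forall j : 'I_N, f (y j) = (j \in S).
Proof.
move=> y_inj S_max; exists (fun t => [exists i in S, y i <= t]%O).
  move=> u v uv; rewrite leEbool.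
  case: (@exists_inP _ _ (fun i : 'I_N => y i <= u)%O) => // -[i iS iu].
  by rewrite lt0b; apply/exists_inP; exists i => //; exact: le_trans uv.
move=> j; apply/exists_inP/idP => [[i iS ij]|jS]; last by exists j.
apply: contraT => jS.
have /y_inj/val_inj ij' : y i = y j by apply/le_anti; rewrite ij S_max.
by rewrite -ij' iS in jS.
Qed.

Lemma bool_halves_at (R : realFieldType) (eps : R) (P : procedure) m k :
  valid_network (2 ^ m + 2 ^ m) (P m) -> k <= 2 ^ m + 2 ^ m ->
  halves01 eps (P m) (2 ^ m) k -> halves_at eps P m k.
Proof.
move=> P_ok kn P_halves n d T x y; rewrite -/n in P_ok kn P_halves.
pose y' := run (P m) (ranked x).
have y'_inj : injective y' by apply: run_inj P_ok _; exact: ranked_inj.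
have y'y i : (y' i).1 = y i by exact: run_ranked.
(* [S] consists of largest entries for both [b]: for [b = false] the [k] positions of interest form
   its complement, so [j = n + n - k]. *)
have rank j b : j <= n + n -> (if b then j else n + n - j) = k ->
    exists S : {set 'I_(n + n)}, [/\ #|S| = j, largest y S
      & (#|[set i : 'I_(n + n) | ((i \in S) == b)
           && (if b then i < n else n <= i)%N]|%:R <= eps * k%:R)%R].
  move=> jn jk; have [S [Sj S_max]] := largest_exists y' jn.
  exists S; split=> //.
    move=> u v uS vS; have := S_max u v uS vS.
    by rewrite leEprodlexi !y'y => /andP[].
  have [f f_homo fS] := threshold y'_inj S_max.
  have fy := run_homo (P m) (ranked x) f_homo.
  have Nk : cnt b (run (P m) (f \o ranked x)) 0 (n + n) = k.
    rewrite /cnt -card_ord_count.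
    transitivity #|[set i : 'I_(n + n) | (i \in S) == b]|.
      by apply: eq_card => i; rewrite !inE fy /= fS.
    rewrite -jk; case: b {jk} => /=.
      by rewrite -Sj; apply: eq_card => i; rewrite inE eqb_id.
    have := cardsC S; rewrite card_ord Sj => /(canRL (addKn j)) <-.
    by apply: eq_card => i; rewrite !inE eqbF_neg.
  rewrite cnt_run // in Nk; apply: le_trans (P_halves _ _ Nk).
  rewrite -card_wrong ler_nat; apply: subset_leq_card; apply/subsetP => i.
  by rewrite !inE fy /= fS.
split.
  have [S [Sk S_max S_le]] := rank k true kn erefl.
  exists S; split=> //; apply: le_trans S_le.
  by rewrite ler_nat; apply: subset_leq_card; apply/subsetP => i;
    rewrite !inE => /andP[->].
have [S [Sk S_max S_le]] := rank (n + n - k) false (leq_subr _ _) (subKn kn).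
exists (~: S); split.
- by rewrite cardsCs setCK card_ord Sk subKn.
- by move=> i j; rewrite !inE negbK => iS jS; exact: S_max.
- apply: le_trans S_le; rewrite ler_nat; apply: subset_leq_card.
  by apply/subsetP => i; rewrite !inE => /andP[/negPf ->].
Qed.

(** * Calls on adjacent intervals *)

Lemma call_iota P m a :
  valid_network (2 ^ m + 2 ^ m) (P m) ->
  call P m (iota a (2 ^ m)) (iota (a + 2 ^ m) (2 ^ m)) = shift a (P m).
Proof.
move=> /allP P_ok; apply/eq_in_map => c /P_ok /andP[c1 c2].
by rewrite -iotaD !nth_iota // (ltn_trans c1).
Qed.

Lemma expn2S m : 2 ^ m.+1 = 2 ^ m + 2 ^ m.
Proof. by rewrite expnS mul2n addnn. Qed.

Lemma first_half_iota a h : first_half (iota a (h + h)) = iota a h.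
Proof.
by rewrite /first_half size_iota addnn doubleK -addnn take_iota (minn_idPl _) ?leq_addr.
Qed.

Lemma second_half_iota a h : second_half (iota a (h + h)) = iota (a + h) h.
Proof.
by rewrite /second_half size_iota addnn doubleK -addnn drop_iota addnK.
Qed.

(** By monotonicity one misplaced [b] would fill the other array with [b], giving more than [n] in
    all. *)
Lemma sorted_wcnt b (z : nat -> bool) a n :
    (forall i j, a <= i <= j -> j < a + (n + n) -> z i -> z j) ->
  cnt b z a (n + n) <= n -> wcnt b z a n = 0.
Proof.
move=> z_sorted; rewrite cntD /wcnt => k_le.
have full c : (forall i, c <= i < c + n -> z i = b) -> cnt b z c n = n.
  move=> zb; rewrite /cnt -[RHS](size_iota c); apply/eqP; rewrite -all_count.
  by apply/allP => i; rewrite mem_iota => /zb /eqP.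
apply/eqP; apply: contraT; rewrite -lt0n -has_count => /hasP[i].
rewrite mem_iota; case: b full k_le => full k_le i_in /eqP zi.
  suff : cnt true z (a + n) n = n.
    have : 0 < cnt true z a n.
      by rewrite -has_count; apply/hasP; exists i; rewrite ?mem_iota ?zi.
    by move: k_le; lia.
  by apply: full => j j_in; apply: (z_sorted i j) => //; lia.
suff : cnt false z a n = n.
  have : 0 < cnt false z (a + n) n.
    by rewrite -has_count; apply/hasP; exists i; rewrite ?mem_iota ?zi.
  by move: k_le; lia.
apply: full => j j_in; apply: contraFF zi => zj.
by apply: (z_sorted j i) => //; lia.
Qed.

(* Attenuate only ever acts on adjacent intervals, A_2 B_1 being the middle of
   A B; hence a call is determined by its left end. *)
Definition att (Sort Halver : procedure) (m a : nat) : network :=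
  attenuate Sort Halver m (iota a (2 ^ m)) (iota (a + 2 ^ m) (2 ^ m)).

(* Both halves of Attenuate's body have this form, the second one acting on
   the arrays A_2, B_1 of half the size. *)
Definition phase (Sort Halver : procedure) (m a : nat) : network :=
  let h := 2 ^ m in
  shift a (Halver m) ++ shift (a + h + h) (Halver m) ++ shift (a + h) (Halver m)
  ++ att Sort Halver m (a + h).

(** * Unfolding and validity of the recursive networks *)

Section Reduce.

Variables (R : realFieldType) (alpha : R) (Halver Sort : procedure).
Hypothesis Halver_halver : halver alpha Halver.
Hypothesis Sort_sorts : forall m : nat, 2 ^ m <= 8 -> sorts Sort m.

Lemma Halver_valid m : valid_network (2 ^ m + 2 ^ m) (Halver m).
Proof. by case: Halver_halver. Qed.

Lemma att_small m a : 2 ^ m <= 8 -> att Sort Halver m a = shift a (Sort m).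
Proof.
move=> m8; rewrite -call_iota; last by case: (Sort_sorts m8).
by rewrite /att; case: m m8 => [|[|m]] m8; rewrite /attenuate ?m8.
Qed.

Lemma attenuateE m A B : 8 < 2 ^ m.+2 ->
  attenuate Sort Halver m.+2 A B =
    call Halver m.+1 (first_half A) (second_half A) ++
    call Halver m.+1 (first_half B) (second_half B) ++
    call Halver m.+1 (second_half A) (first_half B) ++
    attenuate Sort Halver m.+1 (second_half A) (first_half B) ++
    call Halver m (first_half (second_half A)) (second_half (second_half A)) ++
    call Halver m (first_half (first_half B)) (second_half (first_half B)) ++
    call Halver m (second_half (second_half A)) (first_half (first_half B)) ++
    attenuate Sort Halver m (second_half (second_half A)) (first_half (first_half B)).
Proof. by rewrite ltnNge /attenuate => /negPf ->. Qed.

Lemma att_large m a : 8 < 2 ^ m.+2 ->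
  att Sort Halver m.+2 a
    = phase Sort Halver m.+1 a ++ phase Sort Halver m (a + 2 ^ m.+1).
Proof.
move=> m8; rewrite {1}/att attenuateE // [2 ^ m.+2]expn2S.
rewrite !first_half_iota !second_half_iota !addnA !(call_iota _ (Halver_valid _)).
rewrite /phase /att -!catA; do 4!congr (_ ++ _).
rewrite [2 ^ m.+1]expn2S !first_half_iota !second_half_iota !addnA.
by rewrite !(call_iota _ (Halver_valid _)).
Qed.

Lemma inside_phase m a (h := 2 ^ m) :
    (forall c, inside c (h + h) (att Sort Halver m c)) ->
  inside a (h + h + (h + h)) (phase Sort Halver m a).
Proof.
move=> att_in; have Halver_in c : inside c (h + h) (shift c (Halver m)).
  exact/inside_shift/Halver_valid.
have widen c s : inside c (h + h) s -> (a <= c) && (c + (h + h) <= a + (h + h + (h + h))) ->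
    inside a (h + h + (h + h)) s.
  by move=> s_in /andP[ac cN]; apply: inside_widen s_in.
rewrite /phase !inside_cat; do !(apply/andP; split);
  by apply: widen; [exact: Halver_in || exact: att_in | lia].
Qed.

Lemma inside_att m a : inside a (2 ^ m + 2 ^ m) (att Sort Halver m a).
Proof.
elim/ltn_ind: m a => m IHm a.
have [m8|m8] := leqP (2 ^ m) 8.
  by rewrite att_small //; apply: inside_shift; case: (Sort_sorts m8).
case: m m8 IHm => [|[|m]] // m8 IHm; rewrite att_large // inside_cat.
rewrite [2 ^ m.+2]expn2S inside_phase /=; last exact: IHm.
have := inside_phase (a + 2 ^ m.+1) (IHm m (leqnSn _)).
by apply: inside_widen; rewrite ?leq_addr // !expn2S; lia.
Qed.

Lemma halver_at m a b x (n := 2 ^ m) : cnt b x a (n + n) <= n ->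
  ((wcnt b (run (shift a (Halver m)) x) a n)%:R
     <= alpha * (cnt b x a (n + n))%:R)%R.
Proof.
move=> kn; have [_ /(_ m _ kn) /(halves_at_bool (Halver_valid m)) Hm] := Halver_halver.
have xE : cnt b x a (n + n) = cnt b (fun i => x (a + i)) 0 (n + n).
  by rewrite -cnt_shift addn0.
have -> : wcnt b (run (shift a (Halver m)) x) a n
    = wcnt b (run (Halver m) (fun i => x (a + i))) 0 n.
  (* Both possible left ends are written as [a] plus an offset, so that [cnt_shift] applies whatever
     [b] is. *)
  transitivity (cnt b (run (shift a (Halver m)) x) (a + if b then 0 else 0 + n) n).
    by rewrite /wcnt; case: b {kn Hm xE}; rewrite ?addn0 ?add0n.
  by rewrite cnt_shift; apply: eq_cnt => i _; exact: run_shift.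
by apply: Hm; rewrite xE.
Qed.

Lemma reduceE m : reduce Sort Halver m =
  if 2 ^ m <= 8 then shift 0 (Sort m) else shift 0 (Halver m) ++ att Sort Halver m 0.
Proof.
rewrite /reduce; case: leqP => m8.
  exact: (call_iota 0 (Sort_sorts m8).1).
by congr (_ ++ _); exact: (call_iota 0 (Halver_valid m)).
Qed.

Lemma reduce_valid m : valid_network (2 ^ m + 2 ^ m) (reduce Sort Halver m).
Proof.
rewrite -[valid_network _ _]/(inside 0 (2 ^ m + 2 ^ m) _) reduceE; case: leqP => m8.
  exact/inside_shift/(Sort_sorts m8).1.
by rewrite inside_cat inside_att andbT; exact/inside_shift/Halver_valid.
Qed.

(** * Quantitative bounds for Attenuate and Reduce *)

Variable delta : R.
Hypotheses (alpha_gt0 : (0 < alpha)%R) (alpha_le : (alpha <= 1 / 6)%R).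
Hypothesis delta_ge : (alpha + alpha * delta + delta ^+ 2 <= delta)%R.

(** Replacing [alpha] by its bound removes the products of unknowns, so that [lra] can conclude. *)
Lemma alpha_natr_le (t : nat) : (alpha * t%:R <= t%:R / 6)%R.
Proof. by rewrite [leRHS]mulrC ler_wpM2r // -div1r. Qed.

(* Of the [b] in the wrong array, [wf] are in its far half and [wn] in the half
   next to the other array, where similarly [rn] are near and [rf] far.  When
   more than [h] of the [b] are in the right array, its halver is used on the
   fewer than [h] other values there. *)
Lemma near_bound (h wf wn rn rf : nat) :
    rn <= h -> rf <= h ->
    ((wf + wn + (rn + rf))%:R <= 5 / 6 * (h + h)%:R :> R)%R ->
    ((wf + wn)%:R <= alpha * (wf + wn + (rn + rf))%:R)%R ->
    (rn + rf <= h -> (rn%:R <= alpha * (rn + rf)%:R)%R) ->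
    ((h - rn) + (h - rf) <= h ->
      ((h - rf)%:R <= alpha * ((h - rn) + (h - rf))%:R)%R) ->
  ((wn + rn)%:R <= 5 / 6 * h%:R :> R)%R.
Proof.
move=> rnh rfh k_le w_le small big.
have [rh|rh] := leqP (rn + rf) h.
  have := small rh; have := alpha_natr_le (rn + rf).
  have := alpha_natr_le (wf + wn + (rn + rf)).
  have := ler0n R wf; have := ler0n R rf; have := ler0n R wn.
  have := ler0n R h; move: k_le w_le; rewrite !natrD; lra.
(* Here [rn <= 5/6 (rn + rf) - 2/3 h]; together with [wf + wn <= 5/18 h] the sum is at most
   [83/108 h]. *)
have rh' : h - rn + (h - rf) <= h by clear -rnh rfh rh; lia.
have := big rh'; have := alpha_natr_le ((h - rn) + (h - rf)).
have := alpha_natr_le (wf + wn + (rn + rf)).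
have := ler0n R wf; have := ler0n R rf; have := ler0n R wn.
have := ler0n R h; move: k_le w_le; rewrite !natrD !natrB //; lra.
Qed.

(** The bound is relative to the wrong count on entry, not to the total, so that the factors [delta]
    of successive calls multiply. *)
Definition att_good m := forall a b x (n := 2 ^ m),
  ((cnt b x a (n + n))%:R <= 5 / 6 * n%:R :> R)%R ->
  ((wcnt b x a n)%:R <= alpha * (cnt b x a (n + n))%:R)%R ->
  ((wcnt b (run (att Sort Halver m a) x) a n)%:R <= delta * (wcnt b x a n)%:R)%R.

(** [delta_ge] gives [delta * (1 - alpha) >= alpha + delta ^+ 2 > 0]. *)
Lemma delta_gt0 : (0 < delta)%R.
Proof.
rewrite ltNge; apply/negP => d_le0.
have : (delta * (1 - alpha) <= 0)%R by apply: mulr_le0_ge0 => //; move: alpha_le; lra.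
by have := sqr_ge0 delta; move: alpha_gt0 delta_ge; lra.
Qed.

(** If [delta > 1], then [delta ^+ 2 >= delta] and [delta_ge] would force
    [alpha + alpha * delta <= 0]. *)
Lemma delta_le1 : (delta <= 1)%R.
Proof.
rewrite leNgt; apply/negP => d_gt1.
have : (0 <= alpha * delta)%R by rewrite mulr_ge0 ?ltW ?delta_gt0.
have : (delta <= delta ^+ 2)%R by rewrite expr2 ler_peMl ?ltW ?delta_gt0.
by move: alpha_gt0 delta_ge; lra.
Qed.

(** The first two conclusions bound what stays in the far and near halves of the wrong array; the
    last two are the hypotheses again, for the middle, so that a second phase can start there. *)
Lemma phase_good m a b x (h := 2 ^ m) (z := run (phase Sort Halver m a) x) :
    att_good m ->
    ((cnt b x a (h + h + (h + h)))%:R <= 5 / 6 * (h + h)%:R :> R)%R ->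
    ((wcnt b x a (h + h))%:R <= alpha * (cnt b x a (h + h + (h + h)))%:R)%R ->
  [/\ ((cnt b z (if b then a else a + h + h + h) h)%:R
         <= alpha * (wcnt b x a (h + h))%:R)%R,
      ((wcnt b z (a + h) h)%:R <= delta * (wcnt b x a (h + h))%:R)%R,
      ((cnt b z (a + h) (h + h))%:R <= 5 / 6 * h%:R :> R)%R
    & ((wcnt b z (a + h) h)%:R <= alpha * (cnt b z (a + h) (h + h))%:R)%R].
Proof.
move=> IHm k_le w_le.
have Hin c : inside c (h + h) (shift c (Halver m)) by exact/inside_shift/Halver_valid.
pose z1 := run (shift a (Halver m)) x.
pose z2 := run (shift (a + h + h) (Halver m)) z1.
pose z3 := run (shift (a + h) (Halver m)) z2.
have zE : z = run (att Sort Halver m (a + h)) z3 by rewrite /z /phase !run_cat.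
have z1_l b' : cnt b' z1 a (h + h) = cnt b' x a (h + h) by exact: cnt_run.
have z1_r b' : cnt b' z1 (a + h + h) (h + h) = cnt b' x (a + h + h) (h + h).
  by apply: cnt_run_outside (Hin a) _; lia.
have z2_l b' c : c + h <= a + h + h -> cnt b' z2 c h = cnt b' z1 c h.
  by move=> ?; apply: cnt_run_outside (Hin (a + h + h)) _; lia.
have z2_r b' : cnt b' z2 (a + h + h) (h + h) = cnt b' z1 (a + h + h) (h + h).
  exact: cnt_run.
have z_mid : cnt b z (a + h) (h + h) = cnt b z2 (a + h) (h + h).
  by rewrite zE cnt_run ?inside_att // /z3 cnt_run.
have z_out c : (c + h <= a + h) || (a + h + (h + h) <= c) -> cnt b z c h = cnt b z2 c h.
  move=> ?; rewrite zE; rewrite (cnt_run_outside _ _ (inside_att m (a + h))) //.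
  exact: cnt_run_outside (Hin (a + h)) _.
have z3_le : wcnt b z3 (a + h) h <= wcnt b z2 (a + h) h by exact: wcnt_run.
have z3_mid : cnt b z3 (a + h) (h + h) = cnt b z2 (a + h) (h + h) by exact: cnt_run.
have cellC b' c : cnt (~~ b') z2 c h = h - cnt b' z2 c h.
  by rewrite -[X in _ = X - _](cntC b' z2 c h) addKn.
have cell_le b' c : cnt b' z2 c h <= h by rewrite -[leqRHS](cntC b' z2 c h) leq_addr.
(* The wrong array holds at most [5/18 h] of the [b], so its own halver is within range. *)
have w_leh : wcnt b x a (h + h) <= h.
  rewrite -(ler_nat R); have := alpha_natr_le (cnt b x a (h + h + (h + h))).
  by move: k_le w_le (ler0n R h); rewrite (natrD _ h h); lra.
have l_eq b' : cnt b' x a (h + h) = cnt b' z2 a h + cnt b' z2 (a + h) h.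
  by rewrite -z1_l cntD !z2_l //; lia.
have r_eq b' : cnt b' x (a + (h + h)) (h + h)
    = cnt b' z2 (a + h + h) h + cnt b' z2 (a + h + h + h) h.
  by rewrite addnA -z1_r -z2_r cntD.
(* Stated for every [b']: when [b] fills more than half of the right array, the bound is used for
   [~~ b]. *)
have hl b' : cnt b' z2 a h + cnt b' z2 (a + h) h <= h ->
    ((cnt b' z2 (if b' then a else a + h) h)%:R
       <= alpha * (cnt b' z2 a h + cnt b' z2 (a + h) h)%:R)%R.
  rewrite -l_eq => /halver_at; rewrite -/z1 /wcnt -/h z2_l //.
  by case: (b'); lia.
have hr b' : cnt b' z2 (a + h + h) h + cnt b' z2 (a + h + h + h) h <= h ->
    ((cnt b' z2 (if b' then a + h + h else a + h + h + h) h)%:R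
       <= alpha * (cnt b' z2 (a + h + h) h + cnt b' z2 (a + h + h + h) h)%:R)%R.
  by rewrite -r_eq addnA -z1_r => /halver_at.
have [far_le w_eq mid_le] : [/\
    ((cnt b z2 (if b then a else a + h + h + h) h)%:R
       <= alpha * (wcnt b x a (h + h))%:R)%R,
    wcnt b z2 (a + h) h <= wcnt b x a (h + h) &
    ((cnt b z2 (a + h) (h + h))%:R <= 5 / 6 * h%:R :> R)%R].
  rewrite cntD l_eq r_eq in k_le w_le; rewrite cntD.
  move: k_le w_le w_leh; rewrite /wcnt; case: (b) => k_le w_le w_leh.
    rewrite l_eq in w_le w_leh *; split; [exact: hl|exact: leq_addl|].
    apply: near_bound k_le w_le (hr true) _ => //.
    by have := hr false; rewrite !(cellC true).
  rewrite r_eq in w_le w_leh *; split; [exact: hr|exact: leq_addr|].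
  (* For [b = false] the picture is mirrored: the four cells are read from right to left. *)
  have flip p q r s : p + q + (r + s) = s + r + (q + p) by lia.
  rewrite flip in k_le; rewrite flip addnC in w_le.
  rewrite addnC; apply: near_bound k_le _ _ _ => //.
  - by move: (hl false); rewrite addnC.
  - by have := hl true; rewrite !(cellC false) addnC.
have mid_leh : cnt b z2 (a + h) (h + h) <= h.
  by rewrite -(ler_nat R); have := ler0n R h; lra.
have z3_alpha := halver_at mid_leh; rewrite -z3_mid in z3_alpha mid_le.
have z_delta := IHm (a + h) b z3 mid_le z3_alpha; rewrite -zE in z_delta.
rewrite z_out; last by clear -a b h; case: b; lia.
rewrite z_mid -z3_mid; split=> //.
- apply: le_trans z_delta _; rewrite ler_pM2l ?delta_gt0 // ler_nat.
  exact: leq_trans z3_le w_eq.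
(* As [delta <= 1], the recursive call preserves the bound that the halver on the middle has just
   achieved. *)
- apply: le_trans z_delta _; apply: le_trans z3_alpha.
  by rewrite ler_piMl ?delta_le1.
Qed.

Lemma sort_at m a b x (n := 2 ^ m) : 2 ^ m <= 8 ->
  cnt b x a (n + n) <= n -> wcnt b (run (shift a (Sort m)) x) a n = 0.
Proof.
move=> /Sort_sorts[Sort_ok Sort_run] k_le; apply: sorted_wcnt; last first.
  by rewrite cnt_run //; exact: inside_shift.
move=> i j /andP[ai ij] jn.
rewrite -(subnKC ai) -(subnKC (leq_trans ai ij)) !run_shift.
have /Sort_run : i - a <= j - a by exact: leq_sub2r.
move=> /(_ _ _ (fun l => x (a + l))); rewrite ltn_subLR ?(leq_trans ai) // => /(_ jn).
by case: (run _ _ _) (run _ _ _) => [] [].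
Qed.

Lemma five_sixths (k n : nat) : (k%:R <= 5 / 6 * n%:R :> R)%R -> k <= n.
Proof. by rewrite -(ler_nat R); have := ler0n R n; lra. Qed.

Lemma att_is_good m : att_good m.
Proof.
elim/ltn_ind: m => m IHm a b x n k_le w_le; rewrite {}/n in k_le w_le *.
have [m8|m8] := leqP (2 ^ m) 8.
  rewrite att_small // sort_at // ?five_sixths //.
  by rewrite mulr_ge0 ?ler0n // ltW ?delta_gt0.
case: m m8 IHm k_le w_le => [|[|m]] // m8 IHm; rewrite [2 ^ m.+2]expn2S.
move=> k_le w_le; rewrite att_large // run_cat.
have [far_le near_le mid_le mid_w] := phase_good (IHm m.+1 (ltnSn _)) k_le w_le.
move: far_le near_le mid_le mid_w; set z := run (phase _ _ m.+1 a) x.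
rewrite [2 ^ m.+1]expn2S; set q := 2 ^ m; set w := wcnt b x a _.
move=> far_le near_le mid_le mid_w.
have [far2_le near2_le _ _] := phase_good (IHm m (leqnSn _)) mid_le mid_w.
move: far2_le near2_le; rewrite -/q; set z' := run _ z => far2_le near2_le.
have out c : (c + (q + q) <= a + (q + q)) ||
    (a + (q + q) + (q + q + (q + q)) <= c) -> cnt b z' c (q + q) = cnt b z c (q + q).
  move=> ?; apply: (cnt_run_outside (a := a + (q + q)) (N := q + q + (q + q))) => //.
  by apply: inside_phase => c'; exact: inside_att.
(* The wrong array splits into its far half, untouched by the second phase, and the far and near
   halves of its near half: at most [alpha w], [alpha (delta w)] and [delta (delta w)]. *)
have -> : wcnt b z' a (q + q + (q + q))
  = cnt b z (if b then a else a + (q + q) + (q + q) + (q + q)) (q + q)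
    + (cnt b z' (if b then a + (q + q) else a + (q + q) + q + q + q) q
    + wcnt b z' (a + (q + q) + q) q).
  rewrite -out /wcnt; last by clear -a b q; case: b; lia.
  by clear -a b z z' q; case: b; rewrite !cntD !addnA; lia.
have := mulr_ge0 (ltW delta_gt0) (ler0n R w).
have := ler_wpM2l (ltW alpha_gt0) near_le.
have := ler_wpM2l (ltW delta_gt0) near_le.
have := ler_wpM2r (ler0n R w) delta_ge.
rewrite !natrD; lra.
Qed.

(** The initial halver contributes the factor [alpha], Attenuate the factor [delta]; on small sizes
    sorting leaves nothing misplaced. *)
Lemma reduce_halves m k : (k%:R <= 5 / 6 * (2 ^ m)%:R :> R)%R ->
  halves01 (alpha * delta) (reduce Sort Halver m) (2 ^ m) k.
Proof.
move=> k_le b x xk.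
have d_ge0 := ltW delta_gt0; have a_ge0 := ltW alpha_gt0.
rewrite reduceE; case: leqP => m8.
  rewrite sort_at //; last by rewrite xk five_sixths.
  exact: mulr_ge0 (mulr_ge0 a_ge0 d_ge0) (ler0n _ _).
rewrite run_cat; set y := run (shift 0 (Halver m)) x.
have yk : cnt b y 0 (2 ^ m + 2 ^ m) = k.
  by rewrite cnt_run //; exact/inside_shift/Halver_valid.
have w_le : ((wcnt b y 0 (2 ^ m))%:R <= alpha * k%:R)%R.
  by rewrite -xk; apply: halver_at; rewrite xk five_sixths.
apply: le_trans (att_is_good _ _) _; rewrite ?yk //.
by rewrite (mulrC alpha) -mulrA ler_wpM2l.
Qed.

End Reduce.

Local Open Scope ring_scope.

Theorem theorem3 (R : realFieldType) (alpha delta : R)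
    (Halver Sort : procedure)
    (alpha_gt0 : 0 < alpha) (alpha_le : alpha <= 1 / 6)
    (Halver_halver : halver alpha Halver)
    (Sort_sorts : forall m : nat, (2 ^ m <= 8)%N -> sorts Sort m)
    (delta_ge : alpha + alpha * delta + delta ^+ 2 <= delta) :
  partial_halver (alpha * delta) (5 / 6) (reduce Sort Halver).
Proof.
have valid := reduce_valid Halver_halver Sort_sorts.
split=> [m|m k k_le]; first exact: valid.
apply: bool_halves_at (valid m) _ _; last exact: reduce_halves k_le.
by rewrite (leq_trans (five_sixths k_le)) ?leq_addr.
Qed.
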